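(* Let $\Lambda$ be an arbitrary ring. The injective torsion functor $\mathfrak{s}$ on right $\Lambda$-modules is the largest subfunctor of the Bass torsion functor $\mathfrak{t}$ that commutes with filtered colimits. That is, $\mathfrak{s}$ is a subfunctor of $\mathfrak{t}$ which commutes with filtered colimits, and every subfunctor $\mathfrak{u}\subseteq\mathfrak{t}$ which commutes with filtered colimits satisfies $\mathfrak{u}\subseteq\mathfrak{s}$.
   Context: $\Lambda$ is an arbitrary ring with identity and $\iota:\Lambda\to I$ is the injective envelope of $\Lambda$ viewed as a left $\Lambda$-module. For a right $\Lambda$-module $A$, the injective torsion is $\mathfrak{s}(A):=\ker\big(1\otimes\iota: A\otimes_\Lambda\Lambda\to A\otimes_\Lambda I\big)$, identified with a submodule of $A$ via $A\otimes_\Lambda\Lambda\cong A$. The Bass torsion of $A$ is $\mathfrak{t}(A):=\ker(e_A:A\to A^{**})$, where $A^*:=\mathrm{Hom}_\Lambda(A,\Lambda)$ and $e_A$ is the canonical evaluation map. Both are subfunctors of the identity functor on right $\Lambda$-modules. *)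

(* Defs.v *)
From HB Require Import structures.
From mathcomp Require Import all_boot all_algebra.
From mathcomp Require Import boolp.
From mathcomp Require Import freeg.

Set Implicit Arguments.
Unset Strict Implicit.
Unset Printing Implicit Defensive.

Import GRing.Theory.
Local Open Scope ring_scope.
Local Open Scope quotient_scope.

(* For R : pzRingType (the zero ring is allowed), left R-modules are the      *)
(* inhabitants of lmodType R and right R-modules those of lmodType R^c: for   *)
(* a in a right module, (r : R^c) *: a is "a r". As a module over itself, R   *)
(* is R^o on the left and R^c^o on the right.                                 *)

Notation rmodType R := (lmodType R^c).

Lemma linear_ext (S : pzRingType) (U V : lmodType S) (f g : {linear U -> V}) :
  f =1 g -> f = g.
Proof.
case: f g => f [[Af] [Zf]] [g [[Ag] [Zg]]] /= /funext fg; subst g.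
by rewrite (Prop_irrelevance Af Ag) (Prop_irrelevance Zf Zg).
Qed.

Lemma scale_Rc (R : pzRingType) (r : R^c) (x : R^c^o) :
  r *: x = (x : R) * (r : R).
Proof. by []. Qed.

(* A^* = Hom(A, R) for a right module A, a left module: (r f)(a) = r f(a).    *)
Section DualOfRight.
Variables (R : pzRingType) (A : rmodType R).

Definition rdual : Type := {linear A -> R^c^o}.

Definition rdual_app (f : rdual) (a : A) : R := (f : {linear A -> R^c^o}) a.

HB.instance Definition _ := gen_eqMixin rdual.
HB.instance Definition _ := gen_choiceMixin rdual.

Lemma rdualP (f g : rdual) : rdual_app f =1 rdual_app g -> f = g.
Proof. by move=> fg; apply: (@linear_ext _ _ _ (f : {linear _ -> _}) g). Qed.

Lemma rdual_linearP (f : rdual) (r : R^c) (a b : A) :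
  rdual_app f (r *: a + b) = rdual_app f a * r + rdual_app f b.
Proof. by rewrite /rdual_app linearP. Qed.

Section Build.
Variable f : A -> R^c^o.
Hypothesis fP : linear f.
Definition rdual_fun := f.
HB.instance Definition _ := GRing.isLinear.Build R^c A R^c^o *:%R rdual_fun fP.
Definition rdual_mk : rdual := rdual_fun : {linear A -> R^c^o}.
End Build.

Fact rdual_zero_proof : linear (fun _ : A => 0 : R^c^o).
Proof. by move=> r a b; rewrite scaler0 addr0. Qed.

Fact rdual_opp_proof (f : rdual) : linear (fun a : A => - rdual_app f a : R^c^o).
Proof. by move=> r a b; rewrite rdual_linearP opprD scale_Rc mulNr. Qed.

Fact rdual_add_proof (f g : rdual) :
  linear (fun a : A => rdual_app f a + rdual_app g a : R^c^o).
Proof.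
by move=> r a b; rewrite !rdual_linearP scale_Rc mulrDl addrACA.
Qed.

Fact rdual_scale_proof (r : R) (f : rdual) :
  linear (fun a : A => r * rdual_app f a : R^c^o).
Proof. by move=> s a b; rewrite rdual_linearP scale_Rc mulrDr mulrA. Qed.

Definition rdual_zero := rdual_mk rdual_zero_proof.
Definition rdual_opp f := rdual_mk (rdual_opp_proof f).
Definition rdual_add f g := rdual_mk (rdual_add_proof f g).
Definition rdual_scale r f := rdual_mk (rdual_scale_proof r f).

Fact rdual_addA : associative rdual_add.
Proof. by move=> f g h; apply: rdualP => a; apply: addrA. Qed.
Fact rdual_addC : commutative rdual_add.
Proof. by move=> f g; apply: rdualP => a; apply: addrC. Qed.
Fact rdual_add0 : left_id rdual_zero rdual_add.
Proof. by move=> f; apply: rdualP => a; apply: add0r. Qed.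
Fact rdual_addN : left_inverse rdual_zero rdual_opp rdual_add.
Proof. by move=> f; apply: rdualP => a; apply: addNr. Qed.

HB.instance Definition _ := GRing.isZmodule.Build rdual rdual_addA rdual_addC rdual_add0 rdual_addN.

Fact rdual_scaleA r s f : rdual_scale r (rdual_scale s f) = rdual_scale (r * s) f.
Proof. by apply: rdualP => a; apply: mulrA. Qed.
Fact rdual_scale1 : left_id 1 rdual_scale.
Proof. by move=> f; apply: rdualP => a; apply: mul1r. Qed.
Fact rdual_scaleDr : right_distributive rdual_scale +%R.
Proof. by move=> r f g; apply: rdualP => a; apply: mulrDr. Qed.
Fact rdual_scaleDl f : {morph rdual_scale^~ f : r s / r + s}.
Proof. by move=> r s; apply: rdualP => a; apply: mulrDl. Qed.

HB.instance Definition _ :=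
  GRing.Zmodule_isLmodule.Build R rdual rdual_scaleA rdual_scale1 rdual_scaleDr rdual_scaleDl.

End DualOfRight.

(* M^* = Hom(M, R) for a left module M, a right module: (f r)(m) = f(m) r.    *)
Section DualOfLeft.
Variables (R : pzRingType) (M : lmodType R).

Definition ldual : Type := {linear M -> R^o}.

Definition ldual_app (f : ldual) (m : M) : R := (f : {linear M -> R^o}) m.

HB.instance Definition _ := gen_eqMixin ldual.
HB.instance Definition _ := gen_choiceMixin ldual.

Lemma ldualP (f g : ldual) : ldual_app f =1 ldual_app g -> f = g.
Proof. by move=> fg; apply: (@linear_ext _ _ _ (f : {linear _ -> _}) g). Qed.

Lemma ldual_linearP (f : ldual) (r : R) (a b : M) :
  ldual_app f (r *: a + b) = r * ldual_app f a + ldual_app f b.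
Proof. by rewrite /ldual_app linearP. Qed.

Section Build.
Variable f : M -> R^o.
Hypothesis fP : linear f.
Definition ldual_fun := f.
HB.instance Definition _ := GRing.isLinear.Build R M R^o *:%R ldual_fun fP.
Definition ldual_mk : ldual := ldual_fun : {linear M -> R^o}.
End Build.

Fact ldual_zero_proof : linear (fun _ : M => 0 : R^o).
Proof. by move=> r a b; rewrite scaler0 addr0. Qed.

Fact ldual_opp_proof (f : ldual) : linear (fun a : M => - ldual_app f a : R^o).
Proof. by move=> r a b; rewrite ldual_linearP opprD scalerN. Qed.

Fact ldual_add_proof (f g : ldual) :
  linear (fun a : M => ldual_app f a + ldual_app g a : R^o).
Proof. by move=> r a b; rewrite !ldual_linearP scalerDr addrACA. Qed.

Fact ldual_scale_proof (r : R^c) (f : ldual) :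
  linear (fun a : M => ldual_app f a * (r : R) : R^o).
Proof.
by move=> s a b; rewrite ldual_linearP mulrDl -mulrA.
Qed.

Definition ldual_zero := ldual_mk ldual_zero_proof.
Definition ldual_opp f := ldual_mk (ldual_opp_proof f).
Definition ldual_add f g := ldual_mk (ldual_add_proof f g).
Definition ldual_scale r f := ldual_mk (ldual_scale_proof r f).

Fact ldual_addA : associative ldual_add.
Proof. by move=> f g h; apply: ldualP => a; apply: addrA. Qed.
Fact ldual_addC : commutative ldual_add.
Proof. by move=> f g; apply: ldualP => a; apply: addrC. Qed.
Fact ldual_add0 : left_id ldual_zero ldual_add.
Proof. by move=> f; apply: ldualP => a; apply: add0r. Qed.
Fact ldual_addN : left_inverse ldual_zero ldual_opp ldual_add.
Proof. by move=> f; apply: ldualP => a; apply: addNr. Qed.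

HB.instance Definition _ := GRing.isZmodule.Build ldual ldual_addA ldual_addC ldual_add0 ldual_addN.

Fact ldual_scaleA (r s : R^c) f : ldual_scale r (ldual_scale s f) = ldual_scale (r * s) f.
Proof. by apply: ldualP => a; apply/esym/mulrA. Qed.
Fact ldual_scale1 : left_id (1 : R^c) ldual_scale.
Proof. by move=> f; apply: ldualP => a; apply: mulr1. Qed.
Fact ldual_scaleDr : right_distributive ldual_scale +%R.
Proof. by move=> r f g; apply: ldualP => a; apply: mulrDl. Qed.
Fact ldual_scaleDl f : {morph ldual_scale^~ f : r s / r + s}.
Proof. by move=> r s; apply: ldualP => a; apply: mulrDr. Qed.

HB.instance Definition _ :=
  GRing.Zmodule_isLmodule.Build R^c ldual ldual_scaleA ldual_scale1 ldual_scaleDr ldual_scaleDl.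

End DualOfLeft.

Section Bidual.
Variables (R : pzRingType) (A : rmodType R).

Definition bidual := ldual (rdual A).

Fact eval_proof (a : A) : linear (fun f : rdual A => rdual_app f a : R^o).
Proof. by []. Qed.

Definition eval (a : A) : bidual := ldual_mk (eval_proof a).

Lemma evalE a f : ldual_app (eval a) f = rdual_app f a.
Proof. by []. Qed.

Fact eval_linear : linear (eval : A -> ldual (rdual A)).
Proof.
by move=> r a b; apply: ldualP => f; rewrite evalE rdual_linearP.
Qed.

HB.instance Definition _ :=
  GRing.isLinear.Build R^c A (ldual (rdual A)) *:%R eval eval_linear.

End Bidual.

Section Tensor.
Variables (R : pzRingType) (A : rmodType R) (M : lmodType R).

Local Notation F := {freeg (A * M)%type / int}.

Inductive tensor_rel : F -> Prop :=
| tensor_relDl a b m :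
    tensor_rel (<<(a + b, m)>> - <<(a, m)>> - <<(b, m)>>)
| tensor_relDr a m n :
    tensor_rel (<<(a, m + n)>> - <<(a, m)>> - <<(a, n)>>)
| tensor_relZ a (r : R) m :
    tensor_rel (<<((r : R^c) *: a, m)>> - <<(a, r *: m)>>).

(* Membership in the subgroup generated by the relations.                     *)
Definition tensor_null : {pred F} := fun x =>
  `[< forall S : {pred F}, zmod_closed S ->
        (forall y, tensor_rel y -> y \in S) -> x \in S >].

Fact tensor_null_closed : zmod_closed tensor_null.
Proof.
split=> [|x y /asboolP xN /asboolP yN]; apply/asboolP=> S clS SP.
  by case: clS.
by case: (clS) => _; apply; [apply: xN | apply: yN].
Qed.
HB.instance Definition _ :=
  GRing.isZmodClosed.Build F tensor_null tensor_null_closed.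

Local Notation Q := (Quotient.quot tensor_null).

Definition tensor : Type := Q.
HB.instance Definition _ := GRing.Zmodule.copy tensor Q.

Definition tens (a : A) (m : M) : tensor := \pi_Q <<(a, m)>>.

Lemma tensor_null_rel y : tensor_rel y -> \pi_Q y = 0.
Proof.
move=> yR; apply/eqP; rewrite -[0](raddf0 (\pi_Q)).
by rewrite -Quotient.idealrBE subr0; apply/asboolP=> S _; apply.
Qed.

Lemma tensDl a b m : tens (a + b) m = tens a m + tens b m.
Proof.
rewrite [RHS]addrC; have /eqP := tensor_null_rel (tensor_relDl a b m).
by rewrite !raddfB /= subr_eq0 subr_eq => /eqP.
Qed.

Lemma tensDr a m n : tens a (m + n) = tens a m + tens a n.
Proof.
rewrite [RHS]addrC; have /eqP := tensor_null_rel (tensor_relDr a m n).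
by rewrite !raddfB /= subr_eq0 subr_eq => /eqP.
Qed.

Lemma tens0l m : tens 0 m = 0.
Proof. by apply: (addrI (tens 0 m)); rewrite -tensDl !addr0. Qed.

Lemma tensZ a (r : R) m : tens ((r : R^c) *: a) m = tens a (r *: m).
Proof.
by have /eqP := tensor_null_rel (tensor_relZ a r m); rewrite raddfB subr_eq0 => /eqP.
Qed.

Section Lift.
Variables (Z : zmodType) (b : A -> M -> Z).

Definition balanced : Prop :=
  [/\ forall x y m, b (x + y) m = b x m + b y m,
      forall a m n, b a (m + n) = b a m + b a n
    & forall a (r : R) m, b ((r : R^c) *: a) m = b a (r *: m)].

Definition tensor_lin (x : F) : Z := fglift (fun am => b am.1 am.2 : zmodule Z) x.

Fact tensor_linB : zmod_morphism tensor_lin.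
Proof. exact: (lift_is_additive (M := zmodule Z)). Qed.
HB.instance Definition _ := GRing.isZmodMorphism.Build F Z tensor_lin tensor_linB.

Fact tensor_linE a m : tensor_lin <<(a, m)>> = b a m.
Proof. by rewrite /tensor_lin (liftU (M := zmodule Z)) scale1r. Qed.

Definition tensor_lift (x : tensor) : Z := tensor_lin (repr (x : Q)).

Hypothesis bP : balanced.

Fact tensor_lin_null x : x \in tensor_null -> tensor_lin x = 0.
Proof.
move=> /asboolP /(_ [pred y | tensor_lin y == 0]) xN; apply/eqP; apply: xN.
  split=> [|y z /eqP y0 /eqP z0]; apply/eqP; first exact: raddf0 tensor_lin.
  by rewrite tensor_linB y0 z0 subr0.
case: bP => bDl bDr bZ; move=> _ [a c m|a m n|a r m]; apply/eqP; rewrite !tensor_linB.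
- by rewrite !tensor_linE bDl addrAC addrK subrr.
- by rewrite !tensor_linE bDr addrAC addrK subrr.
- by rewrite !tensor_linE bZ subrr.
Qed.

Fact tensor_lift_pi x : tensor_lift (\pi_Q x) = tensor_lin x.
Proof.
apply/eqP; rewrite -subr_eq0 -raddfB; apply/eqP/tensor_lin_null.
by rewrite Quotient.idealrBE reprK.
Qed.

Lemma tensor_lift_zmod_morphism : zmod_morphism tensor_lift.
Proof.
move=> x y; rewrite -[x](reprK (x : Q)).
rewrite -[y](reprK (y : Q)).
rewrite -[X in tensor_lift X](raddfB (\pi_Q)).
by rewrite !tensor_lift_pi raddfB.
Qed.

Lemma tensor_liftE a m : tensor_lift (tens a m) = b a m.
Proof. by rewrite /tens tensor_lift_pi tensor_linE. Qed.

End Lift.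

Lemma tens_balanced : balanced tens.
Proof. by split=> *; rewrite ?tensDl ?tensDr ?tensZ. Qed.

Lemma tensor_ext (Z : zmodType) (f g : {additive tensor -> Z}) :
  (forall a m, f (tens a m) = g (tens a m)) -> f =1 g.
Proof.
move=> fg x; rewrite -[x](reprK (x : Q)).
rewrite -[repr _]freeg_sumE; set D := repr _.
rewrite (raddf_sum (\pi_Q)) !raddf_sum.
apply: eq_bigr => -[a m] _ /=; set c := coeff _ _.
rewrite -[c]intz -freegU_mulz.
by rewrite (raddfMz (\pi_Q)) !raddfMz /=; congr (_ *~ _); apply: fg.
Qed.

End Tensor.

Section TensorMap.
Variables (R : pzRingType) (A B : rmodType R) (M N : lmodType R).
Variables (f : {linear A -> B}) (g : {linear M -> N}).

Definition tensor_map : tensor A M -> tensor B N :=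
  tensor_lift (fun a m => tens (f a) (g m)).

Fact tensor_map_bal : balanced (fun a m => tens (f a) (g m)).
Proof.
by split=> *; rewrite ?linearD ?linearZ ?tensDl ?tensDr //= tensZ.
Qed.

HB.instance Definition _ :=
  GRing.isZmodMorphism.Build (tensor A M) (tensor B N) tensor_map
    (tensor_lift_zmod_morphism tensor_map_bal).

Lemma tensor_mapE a m : tensor_map (tens a m) = tens (f a) (g m).
Proof. exact: (tensor_liftE tensor_map_bal). Qed.

End TensorMap.

(* The isomorphism of A with A (x) R, inverse to a (x) r |-> a r.             *)
Section TensorUnit.
Variables (R : pzRingType) (A : rmodType R).

Definition tensor_unit (a : A) : tensor A R^o := tens a (1 : R^o).

Lemma tensor_unitD a b : tensor_unit (a + b) = tensor_unit a + tensor_unit b.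
Proof. exact: tensDl. Qed.

Lemma tensor_unitZ (r : R) a : tensor_unit ((r : R^c) *: a) = tens a (r : R^o).
Proof. by rewrite /tensor_unit tensZ; congr tens; apply: mulr1. Qed.

Lemma tensor_unit_bij : bijective tensor_unit.
Proof.
pose b (a : A) (r : R^o) := (r : R^c) *: a.
have bal : balanced b.
  by split=> *; rewrite /b ?scalerDr ?scalerDl // scalerA.
exists (tensor_lift b) => [a|x].
  by rewrite tensor_liftE //; apply: scale1r.
pose h x := tensor_unit (tensor_lift b x).
have hB : zmod_morphism h.
  move=> y z; rewrite /h (tensor_lift_zmod_morphism bal).
  apply/eqP; rewrite eq_sym subr_eq -tensor_unitD subrK //.
pose hm := GRing.isZmodMorphism.Build _ _ h hB.
pose ha : {additive tensor A R^o -> tensor A R^o} := HB.pack h hm.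
apply: (tensor_ext (f := ha) (g := idfun)) => a r /=.
by rewrite /h tensor_liftE // tensor_unitZ.
Qed.

End TensorUnit.

Definition injective_module (R : pzRingType) (I : lmodType R) : Prop :=
  forall (X Y : lmodType R) (i : {linear X -> Y}) (f : {linear X -> I}),
    injective i -> exists g : {linear Y -> I}, forall x, g (i x) = f x.

Definition essential (R : pzRingType) (X Y : lmodType R)
    (i : {linear X -> Y}) : Prop :=
  forall S : submodClosed Y,
    (forall x, i x \in S -> i x = 0) -> forall y, y \in S -> y = 0.

Definition injective_envelope (R : pzRingType) (X I : lmodType R)
    (i : {linear X -> I}) : Prop :=
  [/\ injective i, injective_module I & essential i].

(* Subfunctors of the identity functor on right R-modules.                    *)
Record subfunctor (R : pzRingType) := Subfunctor {
  sub_at :> forall A : rmodType R, submodClosed A;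
  sub_natural : forall (A B : rmodType R) (f : {linear A -> B}) (a : A),
    a \in sub_at A -> f a \in sub_at B }.

Definition subfunctor_le (R : pzRingType) (u v : subfunctor R) : Prop :=
  forall (A : rmodType R) (a : A), a \in u A -> a \in v A.

Section BassTorsion.
Variable R : pzRingType.

Definition bass_ker (A : rmodType R) : {pred A} := [pred a | eval a == 0].

Lemma bass_kerP (A : rmodType R) (a : A) :
  (a \in @bass_ker A) <-> forall f : rdual A, rdual_app f a = 0.
Proof.
split=> [/eqP a0 f|a0]; last by apply/eqP/ldualP => f; exact: a0.
exact: (congr1 (fun e => ldual_app e f) a0).
Qed.

Fact bass_ker_closed A : submod_closed (@bass_ker A).
Proof.
split=> [|r a b /eqP a0 /eqP b0]; apply/eqP; first exact: linear0.
by rewrite linearP /= a0 b0 scaler0 addr0.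
Qed.
HB.instance Definition _ A :=
  GRing.isSubmodClosed.Build R^c A (@bass_ker A) (@bass_ker_closed A).

Fact bass_ker_natural (A B : rmodType R) (f : {linear A -> B}) a :
  a \in @bass_ker A -> f a \in @bass_ker B.
Proof.
move=> /eqP a0; apply/eqP/ldualP => g; rewrite evalE.
have hP : linear (fun x => rdual_app g (f x) : R^c^o).
  by move=> r x y; rewrite linearP rdual_linearP.
exact: (congr1 (fun e => ldual_app e (rdual_mk hP)) a0).
Qed.

Definition bass_torsion : subfunctor R := Subfunctor bass_ker_natural.

End BassTorsion.

Section InjectiveTorsion.
Variables (R : pzRingType) (I : lmodType R) (iota : {linear R^o -> I}).
Hypothesis iotaP : injective_envelope iota.

(* The kernel of 1 (x) iota, transported along A ~ A (x) R.                   *)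
Definition injtor_ker (A : rmodType R) : {pred A} :=
  [pred a | tensor_map (idfun : {linear A -> A}) iota (tensor_unit a) == 0].

Fact injtor_kerE A a : (a \in @injtor_ker A) = (tens a (iota 1) == 0).
Proof. by rewrite inE tensor_mapE. Qed.

(* As I need not be a bimodule, stability under right multiplication by r     *)
(* uses an endomorphism of I extending right multiplication by r on R.        *)
Fact injtor_ker_closed A : submod_closed (@injtor_ker A).
Proof.
have [inj_i injI _] := iotaP.
split=> [|r a b].
  by rewrite injtor_kerE tens0l.
rewrite !injtor_kerE => /eqP a0 /eqP b0; rewrite tensDl b0 addr0 tensZ.
have mulP : linear (fun x : R^o => iota ((x : R) * (r : R) : R^o)).
  by move=> s x y; rewrite mulrDl -mulrA -linearP.
pose mulL := GRing.isLinear.Build R R^o I *:%R _ mulP.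
pose mul : {linear R^o -> I} := HB.pack (fun x : R^o => iota ((x : R) * (r : R) : R^o)) mulL.
have [g gE] := injI _ _ iota mul inj_i.
have -> : (r : R) *: iota 1 = g (iota 1).
  rewrite gE -linearZ; congr (iota _); exact: etrans (mulr1 _) (esym (mul1r _)).
by rewrite -(tensor_mapE (idfun : {linear A -> A})) a0 raddf0.
Qed.
HB.instance Definition _ A :=
  GRing.isSubmodClosed.Build R^c A (@injtor_ker A) (@injtor_ker_closed A).

Fact injtor_ker_natural (A B : rmodType R) (f : {linear A -> B}) a :
  a \in @injtor_ker A -> f a \in @injtor_ker B.
Proof.
rewrite !injtor_kerE => /eqP a0.
by rewrite -(tensor_mapE f (idfun : {linear I -> I})) a0 raddf0.
Qed.

Definition injective_torsion : subfunctor R := Subfunctor injtor_ker_natural.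

End InjectiveTorsion.

(* Categories are small: their objects and morphisms live in the universe of  *)
(* the carriers of modules.                                                   *)
Record category := Category {
  obj :> Type@{GRing.Lmodule.axioms_.u0};
  hom : obj -> obj -> Type@{GRing.Lmodule.axioms_.u0};
  idm : forall i, hom i i;
  comp : forall i j k, hom j k -> hom i j -> hom i k;
  comp1m : forall i j (f : hom i j), comp (idm j) f = f;
  compm1 : forall i j (f : hom i j), comp f (idm i) = f;
  compA : forall i j k l (h : hom k l) (g : hom j k) (f : hom i j),
    comp h (comp g f) = comp (comp h g) f }.

Arguments idm {c} i.
Arguments comp {c i j k} _ _.

Definition filtered (J : category) : Prop :=
  [/\ inhabited J,
      forall i j : J, exists k : J, inhabited (hom i k) /\ inhabited (hom j k)
    & forall (i j : J) (f g : hom i j),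
        exists (k : J) (h : hom j k), comp h f = comp h g].

Section Colimits.
Variables (R : pzRingType) (J : category).

Record diagram := Diagram {
  diag_obj :> J -> rmodType R;
  diag_map : forall i j, hom i j -> {linear diag_obj i -> diag_obj j};
  diag_id : forall i x, diag_map (idm i) x = x;
  diag_comp : forall i j k (g : hom j k) (f : hom i j) x,
    diag_map (comp g f) x = diag_map g (diag_map f x) }.

Arguments diag_map d {i j} _.

Record cocone (D : diagram) := Cocone {
  tip : rmodType R;
  leg : forall i, {linear D i -> tip};
  leg_map : forall i j (f : hom i j) x, leg j (diag_map D f x) = leg i x }.

Arguments leg {D} c i.

Definition is_colimit (D : diagram) (c : cocone D) : Prop :=
  forall c' : cocone D, exists! h : {linear tip c -> tip c'},
    forall i x, h (leg c i x) = leg c' i x.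

End Colimits.

Arguments diag_map {R J} d {i j} _.
Arguments leg {R J D} c i.
Arguments Cocone {R J D} tip leg leg_map.

Section Submodule.
Variables (R : pzRingType) (A : lmodType R) (S : submodClosed A).
Definition submodule : Type := {a : A | a \in S}.
HB.instance Definition _ := SubChoice.on submodule.
HB.instance Definition _ := [SubChoice_isSubLmodule of submodule by <:].
End Submodule.

Section SubmoduleMap.
Variables (R : pzRingType) (A B : lmodType R).
Variables (S : submodClosed A) (T : submodClosed B) (f : {linear A -> B}).
Hypothesis fST : forall a, a \in S -> f a \in T.

Definition submodule_map (x : submodule S) : submodule T :=
  exist _ (f (val x)) (fST (valP x)).

Fact submodule_map_linear : linear submodule_map.
Proof. by move=> r x y; apply: val_inj; rewrite /= !linearP. Qed.
HB.instance Definition _ :=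
  GRing.isLinear.Build R (submodule S) (submodule T) *:%R submodule_map
    submodule_map_linear.

End SubmoduleMap.

(* A subfunctor as a functor on right R-modules.                              *)
Section Apply.
Variables (R : pzRingType) (u : subfunctor R).

Definition sub_map (A B : rmodType R) (f : {linear A -> B}) :
    {linear submodule (u A) -> submodule (u B)} :=
  submodule_map (@sub_natural _ u A B f).

Variables (J : category).

Definition apply_diagram (D : diagram R J) : diagram R J.
Proof.
apply: (@Diagram R J (fun i => submodule (u (D i)))
          (fun i j f => sub_map (diag_map D f))) => [i x|i j k g f x].
  by apply: val_inj; rewrite /= diag_id.
by apply: val_inj; rewrite /= diag_comp.
Defined.

Definition apply_cocone (D : diagram R J) (c : cocone D) :
  cocone (apply_diagram D).
Proof.
apply: (@Cocone R J (apply_diagram D) (submodule (u (tip c)))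
          (fun i => sub_map (leg c i))) => i j f x.
by apply: val_inj; rewrite /= leg_map.
Defined.

End Apply.

Definition commutes_with_filtered_colimits (R : pzRingType)
    (u : subfunctor R) : Prop :=
  forall (J : category) (D : diagram R J) (c : cocone D),
    filtered J -> is_colimit c -> is_colimit (apply_cocone u c).

(* Main.v *)
(* The inclusion s <= t holds because a in s(A) and f in A^* give             *)
(* iota (f a) = f a . iota 1 = 0.  As A |-> A (x) I preserves filtered        *)
(* colimits, so does the kernel s.  For maximality, write A = F/K with F free: *)
(* it is the filtered colimit of the modules F/<T>, T a finite subset of K, so *)
(* u(A) is covered by the u(F/<T>) <= t(F/<T>), and it suffices that t <= s on *)
(* such a module.  If v in F represents an element of t(F/<T>), with          *)
(* T = {T_1, .., T_n}, then every combination of coordinates that vanishes on *)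
(* all the T_l vanishes on v; injectivity of I then solves                    *)
(* iota (v_x) = \sum_l T_(l,x) m_l for all x with m_1, .., m_n in I, whence   *)
(* v (x) iota 1 = \sum_l T_l (x) m_l = 0 in F/<T> (x) I.                      *)

From HB Require Import structures.
From mathcomp Require Import all_boot all_algebra.
From mathcomp Require Import boolp functions.
Require Import Defs.

Set Implicit Arguments.
Unset Strict Implicit.
Unset Printing Implicit Defensive.

Import GRing.Theory.
Local Open Scope ring_scope.
Local Open Scope quotient_scope.

(** A cocone over a filtered diagram is a colimit exactly when its legs are jointly onto and an
    element killed by a leg already dies at a later stage ([colimit_of_legs], [colimit_legs]). Both
    colimit claims use this criterion.

    Membership of a in s(A) is the single equation a (x) iota 1 = 0. A functional on A contracts A
    (x) I to I, which gives s <= t ([injtor_sub_bass]). The equation already holds at some stage of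
    a filtered colimit ([tens_colimit_eq0]), which gives [injtor_commutes].

    For maximality, [relations_colimit] presents A as a filtered colimit of quotients of a free
    module by finitely many relations. If u commutes with filtered colimits, each element of u(A)
    comes from u of such a quotient, hence from its Bass torsion. There t <= s by
    [bass_sub_injtor_free]: duality says that a finite linear system with values in I is consistent,
    and injectivity of I solves it. Naturality of s carries the result back to A. *)

Definition mk_linear (S : pzRingType) (U V : lmodType S) (f : U -> V)
    (fL : linear f) : {linear U -> V} :=
  HB.pack f (GRing.isLinear.Build S U V *:%R f fL).

(** * Filtered categories and an explicit model of filtered colimits *)

Section FilteredCategory.
Variable J : category.
Hypothesis filJ : filtered J.

Lemma filtered_obj : exists _ : J, True.
Proof. by case: filJ => -[i] _ _; exists i. Qed.

Lemma filtered_ub (i j : J) : exists k, inhabited (hom i k * hom j k).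
Proof. by case: filJ => _ /(_ i j) [k [[f] [g]]] _; exists k. Qed.

Lemma filtered_span (i j k : J) (f : hom i j) (g : hom i k) :
  exists l (f' : hom j l) (g' : hom k l), comp f' f = comp g' g.
Proof.
have [l [[p q]]] := filtered_ub j k.
case: filJ => _ _ /(_ _ _ (comp p f) (comp q g)) [m [h hE]].
by exists m, (comp h p), (comp h q); rewrite -!compA.
Qed.

End FilteredCategory.

Section FilteredColimit.
Variables (R : pzRingType) (J : category) (D : diagram R J).
Hypothesis filJ : filtered J.

Definition fcolim_pre : Type := {i : J & diag_obj D i}.
HB.instance Definition _ := gen_eqMixin fcolim_pre.
HB.instance Definition _ := gen_choiceMixin fcolim_pre.

Definition fcolim_rel : rel fcolim_pre := fun p q =>
  `[< exists k (f : hom (projT1 p) k) (g : hom (projT1 q) k),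
        diag_map D f (projT2 p) = diag_map D g (projT2 q) >].

Fact fcolim_rel_equiv : equiv_class_of fcolim_rel.
Proof.
split.
- by move=> [i x]; apply/asboolP; exists i, (idm i), (idm i).
- by move=> p q; apply/asboolP/asboolP => -[k [f [g fg]]]; exists k, g, f.
- move=> [j y] [i x] [k z] /asboolP[l [f [g /= xy]]] /asboolP[m [f' [g' /= yz]]].
  have [n [p [q pq]]] := filtered_span filJ g f'.
  apply/asboolP; exists n, (comp p f), (comp q g').
  by rewrite /= !diag_comp xy -yz -!diag_comp pq.
Qed.

Canonical fcolim_equiv := EquivRelPack fcolim_rel_equiv.
Definition fcolim : Type := {eq_quot fcolim_rel}.
HB.instance Definition _ := Choice.copy fcolim {eq_quot fcolim_rel}.

Definition fcolim_in i (x : diag_obj D i) : fcolim :=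
  \pi_({eq_quot fcolim_rel}) (existT _ i x).

Lemma fcolim_inP i j (x : diag_obj D i) (y : diag_obj D j) :
  fcolim_in x = fcolim_in y <->
  exists k (f : hom i k) (g : hom j k), diag_map D f x = diag_map D g y.
Proof.
by split=> [/eqmodP/asboolP//|xy]; apply/eqmodP/asboolP.
Qed.

Lemma fcolim_in_map i j (f : hom i j) x : fcolim_in (diag_map D f x) = fcolim_in x.
Proof.
by apply/fcolim_inP; exists j, (idm j), f; rewrite diag_id.
Qed.

(** For elements of one stage, the two maps provided by [fcolim_inP] are parallel, so filteredness
    coequalises them into a single map. *)
Lemma fcolim_in_eqP i (x y : diag_obj D i) :
  fcolim_in x = fcolim_in y <-> exists k (f : hom i k), diag_map D f x = diag_map D f y.
Proof.
split=> [/fcolim_inP[k [f [g fg]]]|[k [f fxy]]]; last first.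
  by apply/fcolim_inP; exists k, f, f.
case: filJ => _ _ /(_ _ _ f g) [l [h hfg]].
by exists l, (comp h f); rewrite {2}hfg !diag_comp fg.
Qed.

Lemma fcolim_ind (P : fcolim -> Prop) :
  (forall i (x : diag_obj D i), P (fcolim_in x)) -> forall q, P q.
Proof.
by move=> Pin q; rewrite -[q](reprK (q : {eq_quot fcolim_rel})); case: repr => i x; apply: Pin.
Qed.

Lemma fcolim_rep q : exists i (x : diag_obj D i), fcolim_in x = q.
Proof. by elim/fcolim_ind: q => i x; exists i, x. Qed.

Lemma fcolim_rep2 p q :
  exists i (x y : diag_obj D i), fcolim_in x = p /\ fcolim_in y = q.
Proof.
elim/fcolim_ind: p => i x; elim/fcolim_ind: q => j y.
have [k [[f g]]] := filtered_ub filJ i j.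
by exists k, (diag_map D f x), (diag_map D g y); rewrite !fcolim_in_map.
Qed.

Lemma fcolim_rep3 p q r : exists i (x y z : diag_obj D i),
  [/\ fcolim_in x = p, fcolim_in y = q & fcolim_in z = r].
Proof.
have [i [x [y [<- <-]]]] := fcolim_rep2 p q; elim/fcolim_ind: r => j z.
have [k [[f g]]] := filtered_ub filJ i j.
exists k, (diag_map D f x), (diag_map D f y), (diag_map D g z).
by rewrite !fcolim_in_map.
Qed.

Lemma fcolim_op2 (op : forall i, D i -> D i -> D i) :
  (forall i j (f : hom i j) x y,
     diag_map D f (op i x y) = op j (diag_map D f x) (diag_map D f y)) ->
  {F : fcolim -> fcolim -> fcolim |
    forall i x y, F (fcolim_in x) (fcolim_in y) = fcolim_in (op i x y)}.
Proof.
move=> opD; apply: cid.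
have ex p q : exists r, forall i x y, fcolim_in x = p -> fcolim_in y = q ->
    fcolim_in (op i x y) = r.
  have [i [x [y [<- <-]]]] := fcolim_rep2 p q.
  exists (fcolim_in (op i x y)) => j x' y'.
  move=> /fcolim_inP[k [f [g fg]]] /fcolim_inP[k' [f' [g' fg']]].
  (* The arguments are identified at two different stages. Completing the span at i merges these
     stages, but leaves two parallel maps out of j, which [h] then coequalises. *)
  have [l [p1 [q1 pq1]]] := filtered_span filJ f f'.
  case: filJ => _ _ /(_ _ _ (comp p1 g) (comp q1 g')) [m [h hE]].
  apply/fcolim_inP; exists m, (comp h (comp p1 f)), (comp h (comp p1 g)).
  rewrite !opD; congr op; first by rewrite !diag_comp fg.
  by rewrite pq1 hE !diag_comp fg'.
exists (fun p q => projT1 (cid (ex p q))) => i x y.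
by case: cid => r /= ->.
Qed.

Lemma fcolim_op1 (op : forall i, D i -> D i) :
  (forall i j (f : hom i j) x, diag_map D f (op i x) = op j (diag_map D f x)) ->
  {F : fcolim -> fcolim | forall i x, F (fcolim_in x) = fcolim_in (op i x)}.
Proof.
move=> opD; case: (@fcolim_op2 (fun i x _ => op i x)) => [//|F FE].
by exists (fun p => F p p) => i x; rewrite FE.
Qed.

Definition fcolim_add :=
  sval (@fcolim_op2 (fun i => +%R) (fun i j f => linearD (diag_map D f))).
Definition fcolim_opp :=
  sval (@fcolim_op1 (fun i => -%R) (fun i j f => linearN (diag_map D f))).
Definition fcolim_scale (r : R^c) :=
  sval (@fcolim_op1 (fun i => *:%R r) (fun i j f => linearZZ (diag_map D f) r)).

Lemma fcolim_addE i (x y : D i) :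
  fcolim_add (fcolim_in x) (fcolim_in y) = fcolim_in (x + y).
Proof. exact: (svalP (fcolim_op2 _)). Qed.
Lemma fcolim_oppE i (x : D i) : fcolim_opp (fcolim_in x) = fcolim_in (- x).
Proof. exact: (svalP (fcolim_op1 _)). Qed.
Lemma fcolim_scaleE r i (x : D i) : fcolim_scale r (fcolim_in x) = fcolim_in (r *: x).
Proof. exact: (svalP (fcolim_op1 _)). Qed.

Lemma fcolim_in0 i j : fcolim_in (0 : D i) = fcolim_in (0 : D j).
Proof.
have [k [[f g]]] := filtered_ub filJ i j.
by rewrite -(fcolim_in_map f) -(fcolim_in_map g) !linear0.
Qed.

Definition fcolim_zero : fcolim :=
  fcolim_in (0 : D (projT1 (cid (filtered_obj filJ)))).

Lemma fcolim_zeroE i : fcolim_zero = fcolim_in (0 : D i).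
Proof. exact: fcolim_in0. Qed.

Fact fcolim_addA : associative fcolim_add.
Proof.
move=> p q r; have [i [x [y [z [<- <- <-]]]]] := fcolim_rep3 p q r.
by rewrite !fcolim_addE addrA.
Qed.
Fact fcolim_addC : commutative fcolim_add.
Proof.
move=> p q; have [i [x [y [<- <-]]]] := fcolim_rep2 p q.
by rewrite !fcolim_addE addrC.
Qed.
Fact fcolim_add0 : left_id fcolim_zero fcolim_add.
Proof.
by elim/fcolim_ind => i x; rewrite (fcolim_zeroE i) fcolim_addE add0r.
Qed.
Fact fcolim_addN : left_inverse fcolim_zero fcolim_opp fcolim_add.
Proof.
by elim/fcolim_ind => i x; rewrite (fcolim_zeroE i) fcolim_oppE fcolim_addE addNr.
Qed.
HB.instance Definition _ :=
  GRing.isZmodule.Build fcolim fcolim_addA fcolim_addC fcolim_add0 fcolim_addN.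

Fact fcolim_scaleA r s p : fcolim_scale r (fcolim_scale s p) = fcolim_scale (r * s) p.
Proof. by elim/fcolim_ind: p => i x; rewrite !fcolim_scaleE scalerA. Qed.
Fact fcolim_scale1 : left_id 1 fcolim_scale.
Proof. by elim/fcolim_ind => i x; rewrite fcolim_scaleE scale1r. Qed.
Fact fcolim_scaleDr : right_distributive fcolim_scale +%R.
Proof.
move=> r p q; have [i [x [y [<- <-]]]] := fcolim_rep2 p q.
by rewrite /GRing.add /= !fcolim_scaleE !fcolim_addE fcolim_scaleE scalerDr.
Qed.
Fact fcolim_scaleDl p : {morph fcolim_scale^~ p : r s / r + s}.
Proof.
move=> r s; elim/fcolim_ind: p => i x.
by rewrite [RHS]/GRing.add /= !fcolim_scaleE !fcolim_addE scalerDl.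
Qed.
HB.instance Definition _ :=
  GRing.Zmodule_isLmodule.Build R^c fcolim fcolim_scaleA fcolim_scale1 fcolim_scaleDr fcolim_scaleDl.

Fact fcolim_in_linear i : linear (@fcolim_in i : D i -> fcolim).
Proof. by move=> r x y; rewrite -fcolim_addE -fcolim_scaleE. Qed.
HB.instance Definition _ i :=
  GRing.isLinear.Build R^c (D i) fcolim *:%R (@fcolim_in i) (@fcolim_in_linear i).

Definition fcolim_cocone : cocone D :=
  @Cocone R J D fcolim (fun i => @fcolim_in i : {linear D i -> fcolim}) fcolim_in_map.

End FilteredColimit.

(** * Recognising filtered colimits by their legs *)

Section Characterisation.
Variables (R : pzRingType) (J : category) (D : diagram R J).
Hypothesis filJ : filtered J.

Definition legs_onto (c : cocone D) := forall t, exists i x, leg c i x = t.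
Definition legs_exact (c : cocone D) := forall i x, leg c i x = 0 ->
  exists j (f : hom i j), diag_map D f x = 0.

Lemma fcolim_onto : legs_onto (fcolim_cocone D filJ).
Proof. exact: fcolim_rep. Qed.

Lemma fcolim_exact : legs_exact (fcolim_cocone D filJ).
Proof.
move=> i x /= x0; have /fcolim_in_eqP[k [f fx]] : fcolim_in filJ x = fcolim_in filJ (0 : D i).
  by rewrite x0 raddf0.
by exists k, f; rewrite fx raddf0.
Qed.

Lemma colimit_of_legs (c : cocone D) : legs_onto c -> legs_exact c -> is_colimit c.
Proof.
move=> onto exact c'.
have wd i j (x : D i) (y : D j) : leg c i x = leg c j y -> leg c' i x = leg c' j y.
  have [k [[f g]]] := filtered_ub filJ i j => xy.
  (* Exactness speaks only of zero, so it is applied to a difference formed at a common stage. *)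
  have [|l [h /eqP]] := exact k (diag_map D f x - diag_map D g y).
    by rewrite raddfB /= !leg_map xy subrr.
  rewrite raddfB subr_eq0 => /eqP hE.
  by rewrite -(leg_map c' f) -(leg_map c' h) hE !leg_map.
have ex t : exists t', forall i x, leg c i x = t -> leg c' i x = t'.
  by have [i [x <-]] := onto t; exists (leg c' i x) => j y /wd.
pose h t := projT1 (cid (ex t)).
have hE i x : h (leg c i x) = leg c' i x.
  by rewrite /h; case: cid => t' /= ->.
have hL : linear h.
  move=> r s t; have [i [x <-]] := onto s; have [j [y <-]] := onto t.
  have [k [[f g]]] := filtered_ub filJ i j.
  by rewrite -(leg_map c f) -(leg_map c g) -linearP !hE linearP.
exists (mk_linear hL); split; first exact: hE.
by move=> g gE; apply: linear_ext => t; have [i [x <-]] := onto t; rewrite gE -hE.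
Qed.

(** Both properties hold for [fcolim_cocone] and are transported along the comparison maps [h] and
    [g] between the two colimits. *)
Lemma colimit_legs (c : cocone D) : is_colimit c -> legs_onto c /\ legs_exact c.
Proof.
move=> col.
have [h [hE _]] := col (fcolim_cocone D filJ).
have [g [gE _]] := colimit_of_legs fcolim_onto fcolim_exact c.
split=> [t|i x x0]; last first.
  by apply: fcolim_exact; rewrite -hE x0 raddf0.
(* By uniqueness of endomorphisms compatible with the legs, [g \o h] is the identity, so a
   representative of h t is sent by its leg to t. *)
have [k [_ kU]] := col c.
have kgh : k = (g \o h : {linear tip c -> tip c}).
  by apply: kU => i x; rewrite /= hE gE.
have kid : k = (idfun : {linear tip c -> tip c}) by apply: kU.
have [i [x xE]] := fcolim_onto (h t).
by exists i, x; rewrite -gE xE -[LHS]/((g \o h : {linear _ -> _}) t) -kgh kid.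
Qed.

End Characterisation.

(** * Tensor products and filtered colimits *)

Section TensorZero.
Variables (R : pzRingType) (A : rmodType R) (M : lmodType R).

Lemma tens0r (a : A) : tens a (0 : M) = 0.
Proof. by apply: (addrI (tens a 0)); rewrite -tensDr !addr0. Qed.

Lemma tens_suml n (a : 'I_n -> A) (m : M) :
  tens (\sum_i a i) m = \sum_i tens (a i) m.
Proof. exact: (big_morph (fun x : A => tens x m) (fun x y => tensDl x y m) (tens0l A m)). Qed.

Lemma tens_sumr n (a : A) (m : 'I_n -> M) :
  tens a (\sum_i m i) = \sum_i tens a (m i).
Proof. exact: (big_morph (fun y : M => tens a y) (tensDr a) (tens0r a)). Qed.

End TensorZero.

Lemma tensor_lift0 (R : pzRingType) (A : rmodType R) (M : lmodType R)
    (Z : zmodType) (b : A -> M -> Z) : balanced b -> tensor_lift b 0 = 0.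
Proof.
by move=> /tensor_lift_zmod_morphism/(_ 0 0); rewrite subr0 => ->; rewrite subrr.
Qed.

(* Abelian groups as right modules over the integers, so that the colimit of  *)
(* the groups D_i (x) M is again an instance of [fcolim].                      *)
Section IntModule.

Definition int_rmod (Z : zmodType) : Type := Z.

Variable Z : zmodType.
HB.instance Definition _ := GRing.Zmodule.on (int_rmod Z).

Definition int_scale (n : int^c) (x : int_rmod Z) : int_rmod Z := x *~ n.

Fact int_scaleA m n x : int_scale m (int_scale n x) = int_scale (m * n) x.
Proof. by rewrite /int_scale -mulrzA. Qed.
Fact int_scale1 : left_id 1 int_scale.
Proof. by []. Qed.
Fact int_scaleDr : right_distributive int_scale +%R.
Proof. by move=> n x y; apply: mulrzDl. Qed.
Fact int_scaleDl x : {morph int_scale^~ x : m n / m + n}.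
Proof. by move=> m n; apply: mulrzDr. Qed.
HB.instance Definition _ :=
  GRing.Zmodule_isLmodule.Build int^c (int_rmod Z) int_scaleA int_scale1 int_scaleDr int_scaleDl.

End IntModule.

Fact int_linear_proof (Y Z : zmodType) (f : {additive Y -> Z}) :
  linear (f : int_rmod Y -> int_rmod Z).
Proof.
move=> n x y; rewrite [LHS](raddfD f); congr (_ + _); exact: (raddfMz f n x).
Qed.

Definition int_linear (Y Z : zmodType) (f : {additive Y -> Z}) :
    {linear int_rmod Y -> int_rmod Z} :=
  mk_linear (int_linear_proof f).

Section TensorColimit.
Variables (R : pzRingType) (J : category) (D : diagram R J) (M : lmodType R).
Hypothesis filJ : filtered J.

Definition tensor_diagram : diagram int J.
Proof.
apply: (@Diagram int J (fun i => int_rmod (tensor (D i) M))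
  (fun i j f => int_linear (tensor_map (diag_map D f) (idfun : {linear M -> M}))))
  => [i x|i j k g f x].
- apply: (tensor_ext (f := tensor_map (diag_map D (idm i)) idfun) (g := idfun)) => a m.
  by rewrite /= tensor_mapE diag_id.
- apply: (tensor_ext (f := tensor_map (diag_map D (comp g f)) idfun)
    (g := tensor_map (diag_map D g) idfun \o tensor_map (diag_map D f) idfun)) => a m.
  by rewrite /= !tensor_mapE /= diag_comp.
Defined.

(** The legs induce a balanced map from tip c and M to the explicit colimit [E] of the groups D_j
    (x) M. It sends the given tensor to the class of x (x) m, and a zero class in [E] vanishes at a
    later stage. *)
Lemma tens_colimit_eq0 (c : cocone D) i (x : D i) (m : M) :
  is_colimit c -> tens (leg c i x) m = 0 ->
  exists j (f : hom i j), tens (diag_map D f x) m = 0.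
Proof.
move=> /(colimit_legs filJ) [onto exact] xm0.
pose E := fcolim_cocone tensor_diagram filJ.
have legT j k (f : hom j k) y n :
    leg E k (tens (diag_map D f y) n) = leg E j (tens y n).
  rewrite -(leg_map E f); congr (leg E k _); exact/esym/tensor_mapE.
have wd j k (y : D j) (z : D k) n : leg c j y = leg c k z ->
    leg E j (tens y n) = leg E k (tens z n).
  have [l [[f g]]] := filtered_ub filJ j k => yz.
  have [|l' [h /eqP]] := exact l (diag_map D f y - diag_map D g z).
    by rewrite raddfB /= !leg_map yz subrr.
  rewrite raddfB subr_eq0 => /eqP hE.
  by rewrite -(legT _ _ f) -(legT _ _ h) hE !legT.
have ex t : exists b : M -> tip E, forall j y, leg c j y = t ->
    forall n, b n = leg E j (tens y n).
  have [j [y <-]] := onto t; exists (fun n => leg E j (tens y n)) => k z zy n.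
  exact: wd.
pose b t := projT1 (cid (ex t)).
have bE j y n : b (leg c j y) n = leg E j (tens y n).
  by rewrite /b; case: cid => b' /= /(_ j y); apply.
have bal : balanced b.
  split=> [s t n|t n n'|t r n].
  - have [j [y <-]] := onto s; have [k [z <-]] := onto t.
    have [l [[f g]]] := filtered_ub filJ j k.
    by rewrite -(leg_map c f) -(leg_map c g) -raddfD !bE tensDl raddfD.
  - by have [j [y <-]] := onto t; rewrite !bE tensDr raddfD.
  - by have [j [y <-]] := onto t; rewrite -linearZ !bE tensZ.
have : leg E i (tens x m) = 0.
  by rewrite -bE -(tensor_liftE bal) xm0 tensor_lift0.
move=> /fcolim_exact[j [f fx]]; exists j, f.
by rewrite -fx; apply/esym/tensor_mapE.
Qed.

End TensorColimit.

(** * Injective torsion: Bass torsion bound and filtered colimits *)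

Section InjectiveTorsion.
Variables (R : pzRingType) (I : lmodType R) (iota : {linear R^o -> I}).
Hypothesis iotaP : injective_envelope iota.

Lemma mem_injtor (A : rmodType R) (a : A) :
  a \in injective_torsion iotaP A <-> tens a (iota 1) = 0.
Proof.
rewrite -[X in X <-> _]/(is_true (a \in @injtor_ker R I iota A)) injtor_kerE.
by split=> /eqP.
Qed.

Lemma injtor_sub_bass : subfunctor_le (injective_torsion iotaP) (bass_torsion R).
Proof.
move=> A a /mem_injtor a0; apply/bass_kerP => f.
(* The contraction x (x) m |-> f(x) m sends a (x) iota 1 to iota (f a). *)
pose b (x : A) (m : I) : I := rdual_app f x *: m.
have bal : balanced b.
  split=> [x y m|x m n|x r m]; rewrite /b ?scalerDr //.
  - by rewrite -scalerDl /rdual_app linearD.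
  - by rewrite /rdual_app linearZ /= scale_Rc scalerA.
have [iota_inj _ _] := iotaP; apply: iota_inj.
rewrite -[X in iota X](mulr1 (rdual_app f a)) linear0.
have -> : iota (rdual_app f a * 1) = b a (iota 1) by rewrite -[_ * _]/(_ *: (1 : R^o)) linearZ.
by rewrite -(tensor_liftE bal) a0 tensor_lift0.
Qed.

Lemma injtor_commutes : commutes_with_filtered_colimits (injective_torsion iotaP).
Proof.
move=> J D c filJ col; have [onto exact] := colimit_legs filJ col.
apply: colimit_of_legs => // [[t tS]|i [x xS] /(congr1 val) /= x0].
  have [i [x xt]] := onto t.
  (* The representative x need not be torsion itself; its image at a later stage is. *)
  have [|j [f fx]] := tens_colimit_eq0 filJ (x := x) (m := iota 1) col.
    by rewrite xt; apply/mem_injtor.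
  have fS : diag_map D f x \in injective_torsion iotaP (D j) by apply/mem_injtor.
  by exists j, (exist (fun y => y \in injective_torsion iotaP (D j)) _ fS); apply: val_inj; rewrite /= leg_map.
have [j [f fx]] := exact i x x0.
by exists j, f; apply: val_inj.
Qed.

End InjectiveTorsion.

(** * Quotient modules and maps into injective modules *)

Section QuotientModule.
Variables (R : pzRingType) (A : lmodType R) (S : submodClosed A).

(* [submodClosed] does not provide the closure under subtraction that        *)
(* [Quotient.quot] expects.                                                   *)
Definition lquot_null : {pred A} := fun a => a \in S.
Fact lquot_null_closed : zmod_closed lquot_null.
Proof.
split=> [|a b aS bS]; first exact: (rpred0 S).
by rewrite -[a - b]addrC -scaleN1r; apply: (rpredD (rpredZ (-1) bS) aS).
Qed.
HB.instance Definition _ :=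
  GRing.isZmodClosed.Build A lquot_null lquot_null_closed.

Definition lquot : Type := Quotient.quot lquot_null.
HB.instance Definition _ := GRing.Zmodule.copy lquot (Quotient.quot lquot_null).

Definition lquot_pi (a : A) : lquot := \pi_(Quotient.quot lquot_null) a.

Lemma lquot_piP a b : lquot_pi a = lquot_pi b <-> a - b \in S.
Proof.
rewrite -[a - b \in S]/(a - b \in lquot_null) Quotient.idealrBE.
by split=> [/eqP|/eqP].
Qed.

Lemma lquot_ind (P : lquot -> Prop) : (forall a, P (lquot_pi a)) -> forall q, P q.
Proof. by move=> Ppi q; rewrite -[q](reprK (q : Quotient.quot lquot_null)); apply: Ppi. Qed.

Lemma lquot_piD a b : lquot_pi (a + b) = lquot_pi a + lquot_pi b.
Proof. exact: (raddfD (\pi_(Quotient.quot lquot_null))). Qed.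

Definition lquot_scale (r : R) (q : lquot) : lquot :=
  lquot_pi (r *: repr (q : Quotient.quot lquot_null)).

Fact lquot_scaleE r a : lquot_scale r (lquot_pi a) = lquot_pi (r *: a).
Proof.
apply/lquot_piP; rewrite -scalerBr rpredZ //.
by apply/lquot_piP/reprK.
Qed.

Fact lquot_scaleA r s q : lquot_scale r (lquot_scale s q) = lquot_scale (r * s) q.
Proof. by elim/lquot_ind: q => a; rewrite !lquot_scaleE scalerA. Qed.
Fact lquot_scale1 : left_id 1 lquot_scale.
Proof. by elim/lquot_ind => a; rewrite lquot_scaleE scale1r. Qed.
Fact lquot_scaleDr : right_distributive lquot_scale +%R.
Proof.
move=> r p q; elim/lquot_ind: p => a; elim/lquot_ind: q => b.
by rewrite -lquot_piD !lquot_scaleE scalerDr lquot_piD.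
Qed.
Fact lquot_scaleDl q : {morph lquot_scale^~ q : r s / r + s}.
Proof.
by move=> r s; elim/lquot_ind: q => a; rewrite !lquot_scaleE scalerDl lquot_piD.
Qed.
HB.instance Definition _ :=
  GRing.Zmodule_isLmodule.Build R lquot lquot_scaleA lquot_scale1 lquot_scaleDr lquot_scaleDl.

Fact lquot_pi_linear : linear lquot_pi.
Proof. by move=> r a b; rewrite lquot_piD -lquot_scaleE. Qed.
HB.instance Definition _ :=
  GRing.isLinear.Build R A lquot *:%R lquot_pi lquot_pi_linear.

Lemma lquot_pi_eq0 a : lquot_pi a = 0 <-> a \in S.
Proof. by rewrite -(raddf0 lquot_pi) lquot_piP subr0. Qed.

Lemma lquot_lift (B : lmodType R) (f : {linear A -> B}) :
  (forall a, a \in S -> f a = 0) ->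
  {g : {linear lquot -> B} | forall a, g (lquot_pi a) = f a}.
Proof.
move=> fS; pose g (q : lquot) : B := f (repr (q : Quotient.quot lquot_null)).
have gE a : g (lquot_pi a) = f a.
  apply/eqP; rewrite -subr_eq0 -raddfB; apply/eqP/fS/lquot_piP/reprK.
have gL : linear g.
  move=> r p q; elim/lquot_ind: p => a; elim/lquot_ind: q => b.
  by rewrite -linearP !gE linearP.
by exists (mk_linear gL).
Qed.

End QuotientModule.

Arguments lquot_pi {R A} S a.

Section LinearKernel.
Variables (R : pzRingType) (A B : lmodType R) (f : {linear A -> B}).

Definition linear_ker : {pred A} := [pred a | f a == 0].

Fact linear_ker_closed : submod_closed linear_ker.
Proof.
split=> [|r a b /eqP a0 /eqP b0]; apply/eqP; first exact: linear0.
by rewrite linearP a0 b0 scaler0 addr0.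
Qed.
HB.instance Definition _ :=
  GRing.isSubmodClosed.Build R A linear_ker linear_ker_closed.

End LinearKernel.

(** Both maps descend to X / ker phi, which embeds in Y, so injectivity extends the descended psi to
    Y. *)
Lemma injective_module_factor (R : pzRingType) (I : lmodType R) :
  injective_module I ->
  forall (X Y : lmodType R) (phi : {linear X -> Y}) (psi : {linear X -> I}),
    (forall x, phi x = 0 -> psi x = 0) ->
    exists g : {linear Y -> I}, forall x, g (phi x) = psi x.
Proof.
move=> injI X Y phi psi ker.
have [phi' phiE] := lquot_lift (S := linear_ker phi) (f := phi) (fun x => @eqP _ _ _).
have [psi' psiE] : {g : {linear lquot (linear_ker phi) -> I} |
    forall a, g (lquot_pi (linear_ker phi) a) = psi a}.
  by apply: lquot_lift => x /eqP/ker.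
have [p q|g gE] := injI _ _ phi' psi'.
  elim/lquot_ind: p => a; elim/lquot_ind: q => b; rewrite !phiE => ab.
  by apply/lquot_piP/eqP; rewrite raddfB /= ab subrr.
by exists g => x; rewrite -phiE gE.
Qed.

(** * Spans and free modules *)

Section Span.
Variables (R : pzRingType) (F : lmodType R).

Definition span (T : seq F) : {pred F} := fun v =>
  `[< forall S : {pred F}, submod_closed S -> {subset T <= S} -> v \in S >].

Lemma span_min (T : seq F) (S : {pred F}) :
  submod_closed S -> {subset T <= S} -> {subset span T <= S}.
Proof. by move=> clS TS v /asboolP; apply. Qed.

Lemma mem_span (T : seq F) : {subset T <= span T}.
Proof. by move=> v vT; apply/asboolP => S _; apply. Qed.

Fact span_closed T : submod_closed (span T).
Proof.
split=> [|r v w /asboolP vT /asboolP wT]; apply/asboolP => S clS TS.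
  by case: clS.
by case: (clS) => _; apply; [apply: vT | apply: wT].
Qed.
HB.instance Definition _ T :=
  GRing.isSubmodClosed.Build R F (span T) (span_closed T).

End Span.

Section FinitelySupported.
Variables (R : pzRingType) (A : choiceType).

(** The list may exceed the support, so that one list can serve several vectors at once. *)
Definition covers (s : seq A) (f : A -> R^c^o) : Prop :=
  forall x, x \notin s -> f x = 0.

Definition finsupp : {pred A -> R^c^o} := fun f => `[< exists s, covers s f >].

Fact finsupp_closed : submod_closed finsupp.
Proof.
split=> [|r f g /asboolP[s fs] /asboolP[t gt]]; apply/asboolP; first by exists [::].
exists (s ++ t) => x; rewrite mem_cat negb_or => /andP[xs xt].
by rewrite -[LHS]/(r *: f x + g x) fs // gt // scaler0 addr0.
Qed.
HB.instance Definition _ :=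
  GRing.isSubmodClosed.Build R^c (A -> R^c^o) finsupp finsupp_closed.

Definition free_mod : rmodType R := submodule finsupp.

Implicit Types (s : seq A) (v w : free_mod).

Definition coord (x : A) v : R^c^o := val v x.
Fact coord_linear x : linear (coord x).
Proof. by []. Qed.
HB.instance Definition _ x :=
  GRing.isLinear.Build R^c free_mod R^c^o *:%R (coord x) (coord_linear x).

Fact unit_vec_finsupp x : (fun y => (y == x)%:R : R^c^o) \in finsupp.
Proof.
by apply/asboolP; exists [:: x] => y; rewrite inE => /negPf ->.
Qed.
Definition unit_vec x : free_mod :=
  exist (fun f => f \in finsupp) _ (unit_vec_finsupp x).

Lemma finite_cover (T : seq free_mod) :
  exists2 s, uniq s & forall v, v \in T -> covers s (val v).
Proof.
elim: T => [|v T [s _ sT]]; first by exists [::].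
have /asboolP[t vt] := valP v; exists (undup (t ++ s)); first exact: undup_uniq.
move=> w; rewrite inE => /orP[/eqP->|wT] x; rewrite mem_undup mem_cat negb_or => /andP[xt xs].
  exact: vt.
exact: (sT w).
Qed.

Lemma cover_expand s v :
  uniq s -> covers s (val v) -> v = \sum_(x <- s) (coord x v : R^c) *: unit_vec x.
Proof.
move=> us cs; apply: val_inj; apply: funext => y.
rewrite -[RHS]/(coord y (\sum_(x <- s) (coord x v : R^c) *: unit_vec x)) raddf_sum /=.
under eq_bigr => x _ do rewrite linearZ /= -[coord y _]/((y == x)%:R : R).
have [ys|ys] := boolP (y \in s); last first.
  rewrite cs // big_seq big1 // => x xs.
  by case: eqP xs ys => [->->//|_ _ _]; rewrite scaler0.
rewrite (bigD1_seq y) //= eqxx big1 ?addr0 => [|x /negPf].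
  by rewrite scale_Rc mul1r.
by rewrite eq_sym => ->; rewrite scaler0.
Qed.

End FinitelySupported.

Section FreeEvaluation.
Variables (R : pzRingType) (A : rmodType R).
Local Notation F := (free_mod R A).

(** Terms outside either list vanish, so both sums reduce to the common part of s and t. *)
Lemma sum_cover (v : F) (s t : seq A) :
  uniq s -> uniq t -> covers s (val v) -> covers t (val v) ->
  \sum_(x <- s) (coord x v : R^c) *: x = \sum_(x <- t) (coord x v : R^c) *: x.
Proof.
move=> us ut cs ct.
have aux s' t' : covers t' (val v) ->
    \sum_(x <- s') (coord x v : R^c) *: x =
    \sum_(x <- [seq x <- s' | x \in t']) (coord x v : R^c) *: x.
  move=> ct'; rewrite big_filter [RHS]big_mkcond; apply: eq_bigr => x _.
  by case: ifPn => // /ct'; rewrite /coord => ->; rewrite scale0r.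
rewrite (aux s t) // (aux t s) //; apply: perm_big.
by apply: uniq_perm => [||x]; rewrite ?filter_uniq // !mem_filter andbC.
Qed.

Lemma free_eval : {p : {linear F -> A} | forall x, p (unit_vec R x) = x}.
Proof.
have ex (v : F) : exists s, uniq s /\ covers s (val v).
  have [s us sv] := finite_cover [:: v].
  by exists s; split=> //; apply: sv; rewrite mem_head.
pose p v := \sum_(x <- projT1 (cid (ex v))) (coord x v : R^c) *: x.
have pE s v : uniq s -> covers s (val v) -> p v = \sum_(x <- s) (coord x v : R^c) *: x.
  by rewrite /p; case: cid => t [ut ct] /= us cs; apply: sum_cover.
have pL : linear p.
  move=> r v w; have [s us sT] := finite_cover [:: v; w; r *: v + w].
  have psE u : u \in [:: v; w; r *: v + w] ->
      p u = \sum_(x <- s) (coord x u : R^c) *: x by move=> /sT; apply: pE.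
  rewrite !psE ?inE ?eqxx ?orbT // scaler_sumr -big_split /=.
  by apply: eq_bigr => x _; rewrite linearP scalerDl scalerA.
exists (mk_linear pL) => x /=.
rewrite (pE [:: x]) // => [|y]; last by rewrite inE => /negPf /= ->.
by rewrite big_seq1 /coord /= eqxx scale1r.
Qed.

End FreeEvaluation.

(** * Bass torsion of finitely related modules *)

Section BassOfFinitelyRelated.
Variables (R : pzRingType) (I : lmodType R) (iota : {linear R^o -> I}).
Hypothesis iotaP : injective_envelope iota.

(** The dual basis (e_i, c_i) is only asked to expand v and the relations. With C_il = c_i(T_l), the
    aim is to solve iota (c_i v) = \sum_l C_il m_l in I. *)
Lemma bass_sub_injtor_dual_basis (F : rmodType R) (T : seq F) (v : F)
    (p : nat) (e : 'I_p -> F) (c : 'I_p -> rdual F) :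
  (forall w, w \in v :: T -> w = \sum_i (rdual_app (c i) w : R^c) *: e i) ->
  lquot_pi (span T) v \in bass_torsion R (lquot (span T)) ->
  lquot_pi (span T) v \in injective_torsion iotaP (lquot (span T)).
Proof.
have [_ injI _] := iotaP.
move=> expand /bass_kerP v0; apply/mem_injtor.
pose n := size T.
pose C := \matrix_(i < p, l < n) rdual_app (c i) T`_l.
pose comb (r : 'rV[R]_p) : rdual F := \sum_i r 0 i *: c i.
have combE r w : rdual_app (comb r) w = \sum_i r 0 i * rdual_app (c i) w.
  pose at_w (f : rdual F) := rdual_app f w.
  exact: (big_morph at_w (id1 := 0) (op1 := +%R)).
pose psi (r : 'rV[R]_p) : I := iota (rdual_app (comb r) v : R^o).
have combP a r s w :
    rdual_app (comb (a *: r + s)) w = a * rdual_app (comb r) w + rdual_app (comb s) w.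
  rewrite !combE mulr_sumr -big_split; apply: eq_bigr => i _ /=.
  by rewrite !mxE mulrDl mulrA.
have psiL : linear psi by move=> a r s; rewrite /psi combP; apply: (linearP iota).
pose psi' := mk_linear psiL.
(* Consistency of the system: if r C = 0, then [comb r] kills the relations and induces a functional
   on the quotient, which vanishes on the class of v. Hence psi factors through r |-> r C. *)
have [r rC|g gE] := injective_module_factor injI (phi := mulmxr C) (psi := psi').
  have ker w : w \in span T -> rdual_app (comb r) w = 0.
    pose K := linear_ker (comb r : {linear F -> R^c^o}).
    move=> wT; apply/eqP; move: w wT; apply: (@span_min _ _ T K).
      exact: linear_ker_closed.
    move=> w wT; apply/eqP; rewrite -[LHS]/(rdual_app (comb r) w) combE.
    have lt : (index w T < n)%N by rewrite index_mem.
    have := congr1 (fun u : 'rV[R]_n => u 0 (Ordinal lt)) rC; rewrite !mxE; apply: etrans.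
    by apply: eq_bigr => i _; rewrite mxE /= nth_index.
  have [h hE] := lquot_lift (f := (comb r : {linear F -> R^c^o})) ker.
  have := v0 (h : rdual _); rewrite /rdual_app hE => hv.
  by rewrite /= /psi /rdual_app hv linear0.
pose m l := g (delta_mx 0 l).
have gC i : iota (rdual_app (c i) v : R^o) = \sum_l C i l *: m l.
  transitivity (psi' (delta_mx 0 i)).
    rewrite /= /psi combE (bigD1 i) //= big1 ?addr0 => [|j /negPf ji].
      by rewrite mxE !eqxx mul1r.
    by rewrite mxE ji andbF mul0r.
  rewrite -gE /= -rowE (row_sum_delta (row i C)) raddf_sum /=.
  by apply: eq_bigr => l _; rewrite linearZ /= mxE.
have piE w : w \in v :: T -> lquot_pi (span T) w =
    \sum_i (rdual_app (c i) w : R^c) *: lquot_pi (span T) (e i).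
  move=> /expand {1}->; rewrite raddf_sum; apply: eq_bigr => i _; exact: linearZ.
rewrite piE ?mem_head // tens_suml.
(* The coordinate c_i(v) moves across the tensor, where it turns iota 1 into iota (c_i v). *)
transitivity (\sum_i \sum_l tens (lquot_pi (span T) (e i)) (C i l *: m l)).
  apply: eq_bigr => i _; rewrite tensZ -tens_sumr -gC -linearZ.
  by congr (tens _ (iota _)); apply: mulr1.
rewrite exchange_big big1 //= => l _.
(* Moving the C_il back and summing over i reassembles the relation T_l, which is zero in the
   quotient. *)
transitivity (tens (lquot_pi (span T) T`_l) (m l)).
  rewrite piE ?inE ?mem_nth ?orbT // tens_suml.
  by apply: eq_bigr => i _; rewrite tensZ mxE.
suff -> : lquot_pi (span T) T`_l = 0 by rewrite tens0l.
by apply/lquot_pi_eq0/mem_span/mem_nth.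
Qed.

Lemma bass_sub_injtor_free (X : choiceType) (T : seq (free_mod R X))
    (q : lquot (span T)) :
  q \in bass_torsion R (lquot (span T)) -> q \in injective_torsion iotaP (lquot (span T)).
Proof.
elim/lquot_ind: q => v.
have [s us sT] := finite_cover (v :: T).
pose x i := tnth (in_tuple s) i.
pose c i : rdual (free_mod R X) := coord (x i) : {linear free_mod R X -> R^c^o}.
apply: (@bass_sub_injtor_dual_basis _ T v _ (fun i => unit_vec R (x i)) c) => w wT.
by rewrite {1}(cover_expand us (sT w wT)) big_tnth.
Qed.

End BassOfFinitelyRelated.

(** * Presenting a module as a filtered colimit over finite sets of relations *)

Section FinitelyRelatedColimit.
Variables (R : pzRingType) (F A : rmodType R) (p : {linear F -> A}).
Hypothesis p_onto : forall a, exists v, p v = a.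

Definition relations : Type := {T : seq F | all (linear_ker p) T}.
(** This is a preorder with values in Prop, so parallel morphisms of [relations_cat] coincide and
    filteredness reduces to upper bounds. *)
Definition relations_le (S T : relations) : Prop := {subset sval S <= span (sval T)}.

Lemma relations_le_refl S : relations_le S S.
Proof. exact: mem_span. Qed.

Lemma relations_le_span S T : relations_le S T -> {subset span (sval S) <= span (sval T)}.
Proof. exact/span_min/span_closed. Qed.

Lemma relations_le_trans S T U :
  relations_le T U -> relations_le S T -> relations_le S U.
Proof. by move=> /relations_le_span TU ST v /ST/TU. Qed.

Definition relations_cat : category.
Proof.
by apply: (@Category relations relations_le relations_le_refl relations_le_trans)
  => *; apply: Prop_irrelevance.
Defined.

Lemma relations_filtered : filtered relations_cat.
Proof.
split=> [|S T|S T f g]; first by constructor; exists [::].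
- have ST : all (linear_ker p) (sval S ++ sval T) by rewrite all_cat (svalP S) (svalP T).
  exists (exist (fun U => all (linear_ker p) U) _ ST); split; constructor=> v vS;
    by apply: mem_span; rewrite mem_cat vS ?orbT.
- by exists T, (idm T); apply: (@Prop_irrelevance (relations_le S T)).
Qed.

Lemma span_relations (S : relations) v : v \in span (sval S) -> p v = 0.
Proof.
move=> vS; apply/eqP; move: v vS; apply: span_min; first exact: (linear_ker_closed p).
exact/allP/(svalP S).
Qed.

Lemma relations_pi (S T : relations) v :
  relations_le S T -> v \in span (sval S) -> lquot_pi (span (sval T)) v = 0.
Proof. by move=> /relations_le_span ST /ST /lquot_pi_eq0. Qed.

Definition relations_map S T (ST : relations_le S T) :=
  sval (lquot_lift (f := lquot_pi (span (sval T))) (fun v => @relations_pi S T v ST)).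

Lemma relations_mapE S T (ST : relations_le S T) v :
  relations_map ST (lquot_pi _ v) = lquot_pi _ v.
Proof. exact: (svalP (lquot_lift _)). Qed.

Definition relations_diagram : diagram R relations_cat.
Proof.
apply: (@Diagram R relations_cat (fun S => lquot (span (sval S))) relations_map)
  => [S|S T U g f].
  by elim/lquot_ind => v; rewrite relations_mapE.
by elim/lquot_ind => v; rewrite !relations_mapE.
Defined.

Definition relations_leg S := sval (lquot_lift (f := p) (@span_relations S)).

Lemma relations_legE S v : relations_leg S (lquot_pi _ v) = p v.
Proof. exact: (svalP (lquot_lift _)). Qed.

Definition relations_cocone : cocone relations_diagram.
Proof.
apply: (@Cocone R relations_cat relations_diagram A relations_leg) => S T f.
by elim/lquot_ind => v; rewrite /= relations_mapE !relations_legE.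
Defined.

Lemma relations_colimit : is_colimit relations_cocone.
Proof.
apply: (colimit_of_legs relations_filtered) => [a|S].
  have [v <-] := p_onto a.
  by exists (exist _ [::] isT), (lquot_pi _ v); apply: relations_legE.
elim/lquot_ind => v /=; rewrite relations_legE => v0.
(* An element v of the kernel of p dies once v itself is adjoined to the relations. *)
have vS : all (linear_ker p) (v :: sval S) by rewrite /= (svalP S) andbT; apply/eqP.
have le : relations_le S (exist (fun U => all (linear_ker p) U) _ vS).
  by move=> w wS; apply: mem_span; rewrite inE wS orbT.
exists (exist (fun U => all (linear_ker p) U) _ vS), le.
by rewrite relations_mapE; apply/lquot_pi_eq0/mem_span/mem_head.
Qed.

End FinitelyRelatedColimit.

Theorem proposition2p18 (R : pzRingType) (I : lmodType R)
    (iota : {linear R^o -> I}) (iotaP : injective_envelope iota) :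
  [/\ subfunctor_le (injective_torsion iotaP) (bass_torsion R),
      commutes_with_filtered_colimits (injective_torsion iotaP)
    & forall u : subfunctor R,
        subfunctor_le u (bass_torsion R) ->
        commutes_with_filtered_colimits u ->
        subfunctor_le u (injective_torsion iotaP)].
Proof.
split; [exact: injtor_sub_bass | exact: injtor_commutes |].
move=> u ut uC A a ua.
have [p pE] := free_eval A.
have p_onto b : exists v, p v = b by exists (unit_vec R b).
have filJ := relations_filtered p.
have /(colimit_legs filJ)[onto _] := uC _ _ _ filJ (relations_colimit p_onto).
(* Only surjectivity of the legs on u is used: a lifts to an element x of u at the stage S. *)
have [S [[x ux] /(congr1 val) /= <-]] := onto (exist (fun b => b \in u A) a ua).
apply: (@sub_natural _ (injective_torsion iotaP) _ _ (relations_leg S) x).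
exact/bass_sub_injtor_free/ut.
Qed.
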